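(* Let $\mathcal{C}$ be a bounded below graded poset and let $H:\mathcal{C}\to\mathrm{Ab}$ be a functor. Then there is a sequence of functors $H=K_0,K_1,K_2,\dots$ in $\mathrm{Ab}^{\mathcal{C}}$ such that, for each $j\ge 1$, $$\varinjlim_j H\cong\varinjlim_1 K_{j-1}.$$
   Context: A poset is regarded as a category with exactly one arrow $p\to p'$ when $p\le p'$. For $p<p'$, $p$ precedes $p'$ if $p\le p''\le p'$ implies $p''=p$ or $p''=p'$. A graded poset is a poset together with an (increasing) degree function $\deg:\mathrm{Ob}(\mathcal{C})\to\mathbb{Z}$ which is strictly order preserving and such that $\deg(p')=\deg(p)+1$ whenever $p$ precedes $p'$. It is bounded below if the set of values of $\deg$ has a lower bound. $\varinjlim_j:\mathrm{Ab}^{\mathcal{C}}\to\mathrm{Ab}$ is the $j$-th left derived functor of the colimit functor. *)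

(* Defs.v *)
From HB Require Import structures.
From mathcomp Require Import all_boot all_order all_algebra.
From mathcomp Require Import generic_quotient ring_quotient.
From mathcomp Require Import boolp.
From mathcomp.multinomials Require Import freeg.

Set Implicit Arguments.
Unset Strict Implicit.
Unset Printing Implicit Defensive.

Import Order.TTheory GRing.Theory.
Local Open Scope ring_scope.
Local Open Scope quotient_scope.

Definition mk_additive (U V : zmodType) (f : U -> V) (h : zmod_morphism f) :
  {additive U -> V} := HB.pack f (GRing.isZmodMorphism.Build U V f h).

Definition zmod_iso (U V : zmodType) : Prop :=
  exists f : {additive U -> V}, bijective f.

Notation "U ≅ V" := (zmod_iso U V) (at level 70, no associativity).

Section FreeAbelianGroup.

Variables (T : choiceType).

Definition freeAb : zmodType := {freeg T}.
Definition gen (t : T) : freeAb := << t >>.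

Variable M : zmodType.

Lemma free_lift_zmod_morphism (f : T -> M) :
  zmod_morphism (fglift (f : T -> zmodule M) : freeAb -> M).
Proof. by move=> x y; apply: (@lift_is_additive int T (zmodule M) f). Qed.

Definition free_lift (f : T -> M) : {additive freeAb -> M} :=
  mk_additive (@free_lift_zmod_morphism f).

Lemma free_liftE (f : T -> M) t : free_lift f (gen t) = f t.
Proof. by rewrite /= liftU scale1r. Qed.

Lemma free_ext (f g : {additive freeAb -> M}) :
  (forall t, f (gen t) = g (gen t)) -> f =1 g.
Proof.
move=> fg x; rewrite -(freeg_sumE x) !raddf_sum; apply: eq_bigr => z _.
by rewrite -[coeff _ _]intz -freegU_mulz !raddfMz fg.
Qed.

End FreeAbelianGroup.

Section Quotient.

Variables (G : zmodType) (N : G -> Prop).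
Hypotheses (N0 : N 0) (NB : forall x y, N x -> N y -> N (x - y)).

Let npred : {pred G} := fun x => `[< N x >].

Lemma npred_zmod_closed : zmod_closed npred.
Proof.
split; first exact/asboolP.
by move=> x y /asboolP Nx /asboolP Ny; apply/asboolP/NB.
Qed.

Let nsub : zmodClosed G :=
  HB.pack npred (GRing.isZmodClosed.Build G npred npred_zmod_closed).

Definition quo : zmodType := Quotient.quot nsub.

Definition quo_pi : {additive G -> quo} :=
  mk_additive (@pi_is_zmod_morphism _ _ _ (Quotient.quot nsub)).

Lemma quo_pi_surj (y : quo) : exists x, quo_pi x = y.
Proof. by exists (repr y); rewrite /= reprK. Qed.

Lemma quo_pi_eq0 x : quo_pi x = 0 <-> N x.
Proof.
have -> : (quo_pi x = 0) <-> (x - 0 \in nsub).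
  rewrite Quotient.idealrBE -(raddf0 quo_pi) /=; split; first by move=> ->.
  by move/eqP.
by rewrite subr0; split => /asboolP.
Qed.

Section Lift.

Variables (M : zmodType) (f : {additive G -> M}).
Hypothesis fN : forall x, N x -> f x = 0.

Let lift (y : quo) : M := f (repr (y : Quotient.quot nsub)).

Let lift_pi x : lift (quo_pi x) = f x.
Proof.
apply/eqP; rewrite -subr_eq0 -raddfB; apply/eqP/fN/quo_pi_eq0.
by rewrite raddfB /= reprK subrr.
Qed.

Lemma quo_lift_zmod_morphism : zmod_morphism lift.
Proof.
move=> x y; have [a <-] := quo_pi_surj x; have [b <-] := quo_pi_surj y.
by rewrite -raddfB !lift_pi raddfB.
Qed.

Definition quo_lift : {additive quo -> M} := mk_additive quo_lift_zmod_morphism.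

Lemma quo_liftE x : quo_lift (quo_pi x) = f x.
Proof. exact: lift_pi. Qed.

End Lift.

End Quotient.

Section Kernel.

Variables (U V : zmodType) (f : {additive U -> V}).

Definition kerp : {pred U} := fun x => f x == 0.

Lemma kerp_zmod_closed : zmod_closed kerp.
Proof.
split; first by rewrite unfold_in raddf0.
by move=> x y /eqP fx /eqP fy; rewrite unfold_in raddfB fx fy subrr.
Qed.

HB.instance Definition _ := GRing.isZmodClosed.Build U kerp kerp_zmod_closed.

Definition ker := {x : U | x \in kerp}.
HB.instance Definition _ := SubType.on ker.
HB.instance Definition _ := Choice.on ker.
HB.instance Definition _ := [SubChoice_isSubZmodule of ker by <:].

Definition ker_val : {additive ker -> U} := val.

Lemma kerP (x : ker) : f (ker_val x) = 0.
Proof. exact/eqP/(valP x). Qed.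

End Kernel.

Arguments ker_val {U V f}.

Section Homology.

Variables (A B D : zmodType) (f : {additive A -> B}) (g : {additive B -> D}).

Definition boundary (z : ker g) : Prop := exists a, f a = ker_val z.

Lemma boundary0 : boundary 0.
Proof. by exists 0; rewrite !raddf0. Qed.

Lemma boundaryB x y : boundary x -> boundary y -> boundary (x - y).
Proof. by move=> [a fa] [b fb]; exists (a - b); rewrite !raddfB fa fb. Qed.

(* ker g / (ker g `&` im f) *)
Definition homology : zmodType := quo boundary0 boundaryB.

End Homology.

Section FunctorCategory.

Variables (disp : Order.disp_t) (C : porderType disp).

Record functor := Functor {
  fobj :> C -> zmodType;
  fmap : forall p q, (p <= q)%O -> {additive fobj p -> fobj q};
  fmap_id : forall p (h : (p <= p)%O) x, fmap h x = x;
  fmap_comp : forall p q r (h : (p <= q)%O) (k : (q <= r)%O) (l : (p <= r)%O) x,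
    fmap l x = fmap k (fmap h x)
}.

Record nat_trans (F G : functor) := NatTrans {
  nt_app :> forall p, {additive F p -> G p};
  nt_natural : forall p q (h : (p <= q)%O) x,
    nt_app q (fmap F h x) = fmap G h (nt_app p x)
}.

Lemma nt_comp_natural (F G H : functor) (b : nat_trans G H) (a : nat_trans F G)
    p q (h : (p <= q)%O) x :
  (b q \o a q) (fmap F h x) = fmap H h ((b p \o a p) x).
Proof. by rewrite /= !nt_natural. Qed.

Definition nt_comp (F G H : functor) (b : nat_trans G H) (a : nat_trans F G) :
  nat_trans F H := NatTrans (nt_comp_natural b a).

(* Epimorphisms and exactness in Ab^C are pointwise. *)
Definition nt_epi (F G : functor) (e : nat_trans F G) : Prop :=
  forall p y, exists x, e p x = y.

Definition exact_at (F G H : functor) (a : nat_trans F G) (b : nat_trans G H) :=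
  forall p y, b p y = 0 <-> exists x, a p x = y.

Definition projective (P : functor) : Prop :=
  forall (A B : functor) (e : nat_trans A B) (f : nat_trans P B),
    nt_epi e -> exists g : nat_trans P A, forall p x, e p (g p x) = f p x.

Record resolution (F : functor) := Resolution {
  res_obj :> nat -> functor;
  res_d : forall n, nat_trans (res_obj n.+1) (res_obj n);
  res_aug : nat_trans (res_obj 0%N) F;
  res_projective : forall n, projective (res_obj n);
  res_aug_epi : nt_epi res_aug;
  res_exact0 : exact_at (res_d 0%N) res_aug;
  res_exactS : forall n, exact_at (res_d n.+1) (res_d n)
}.

Section Colimit.

Variable F : functor.

Definition elt : choiceType := {p : C & F p}.
Definition mk_elt p (x : F p) : elt := Tagged (fun p => F p : Type) x.

(* The colimit is the direct sum of the F p modulo x ~ F(p <= q) x; both the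
   sum and the quotient are presented by the generators (p, x), x in F p. *)
Inductive colim_null : freeAb elt -> Prop :=
| CNadd p (x y : F p) :
    colim_null (gen (mk_elt (x + y)) - (gen (mk_elt x) + gen (mk_elt y)))
| CNmap p q (h : (p <= q)%O) (x : F p) :
    colim_null (gen (mk_elt (fmap F h x)) - gen (mk_elt x))
| CN0 : colim_null 0
| CNB u v : colim_null u -> colim_null v -> colim_null (u - v).

Definition colim : zmodType := quo CN0 CNB.

Lemma colim_in_zmod_morphism p :
  zmod_morphism (fun x : F p => quo_pi CN0 CNB (gen (mk_elt x))).
Proof.
have D (a b : F p) : quo_pi CN0 CNB (gen (mk_elt (a + b))) =
    quo_pi CN0 CNB (gen (mk_elt a)) + quo_pi CN0 CNB (gen (mk_elt b)).
  apply/eqP; rewrite -subr_eq0 -raddfD -raddfB; apply/eqP/quo_pi_eq0.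
  exact: CNadd.
by move=> x y; apply/eqP; rewrite eq_sym subr_eq -D subrK.
Qed.

Definition colim_in p : {additive F p -> colim} :=
  mk_additive (@colim_in_zmod_morphism p).

Lemma colim_in_map p q (h : (p <= q)%O) x :
  colim_in q (fmap F h x) = colim_in p x.
Proof.
apply/eqP; rewrite -subr_eq0 /= -raddfB; apply/eqP/quo_pi_eq0; exact: CNmap.
Qed.

Section Desc.

Variables (M : zmodType) (f : forall p, {additive F p -> M}).
Hypothesis f_cocone : forall p q (h : (p <= q)%O) x, f q (fmap F h x) = f p x.

Lemma colim_null_desc u :
  colim_null u -> free_lift (fun t : elt => f (tag t) (tagged t)) u = 0.
Proof.
elim=> [p x y|p q h x||v w _ v0 _ w0].
- by rewrite raddfB raddfD !free_liftE /= raddfD subrr.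
- by rewrite raddfB !free_liftE /= f_cocone subrr.
- exact: raddf0.
- by rewrite raddfB v0 w0 subrr.
Qed.

Definition colim_desc : {additive colim -> M} :=
  quo_lift CN0 CNB colim_null_desc.

Lemma colim_descE p x : colim_desc (colim_in p x) = f p x.
Proof. by rewrite [LHS]quo_liftE free_liftE. Qed.

Lemma colim_desc_unique (g : {additive colim -> M}) :
  (forall p x, g (colim_in p x) = f p x) -> g =1 colim_desc.
Proof.
move=> gE y; have [u <-] := quo_pi_surj y.
have := @free_ext _ _ (mk_additive (raddfB (g \o quo_pi CN0 CNB)))
  (mk_additive (raddfB (colim_desc \o quo_pi CN0 CNB))).
by apply=> -[p x]; rewrite [LHS]gE [RHS]colim_descE.
Qed.

End Desc.

End Colimit.

Section ColimMap.

Variables (F G : functor) (a : nat_trans F G).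

Definition colim_leg p : {additive F p -> colim G} := colim_in G p \o a p.

Lemma colim_leg_cocone p q (h : (p <= q)%O) x :
  colim_leg q (fmap F h x) = colim_leg p x.
Proof. by rewrite /= nt_natural [LHS]colim_in_map. Qed.

Definition colim_map : {additive colim F -> colim G} :=
  colim_desc colim_leg_cocone.

End ColimMap.

Section FreeCover.

Variable F : functor.

Definition cov_gen (q : C) : choiceType := {t : elt F | (tag t <= q)%O}.
Definition cov_obj (q : C) : zmodType := freeAb (cov_gen q).
Definition cov_push q r (h : (q <= r)%O) (t : cov_gen q) : cov_gen r :=
  exist _ (val t) (le_trans (valP t) h).
Definition cov_map q r (h : (q <= r)%O) : {additive cov_obj q -> cov_obj r} :=
  free_lift (fun t => gen (cov_push h t)).

Lemma cov_mapE q r (h : (q <= r)%O) t :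
  cov_map h (gen t) = gen (cov_push h t).
Proof. exact: free_liftE. Qed.

Lemma cov_map_id q (h : (q <= q)%O) x : cov_map h x = x.
Proof.
apply: (@free_ext _ _ (cov_map h) idfun) => t; rewrite [LHS]cov_mapE.
by congr (gen _); apply: val_inj.
Qed.

Lemma cov_map_comp p q r (h : (p <= q)%O) (k : (q <= r)%O) (l : (p <= r)%O) x :
  cov_map l x = cov_map k (cov_map h x).
Proof.
apply: (@free_ext _ _ (cov_map l) (cov_map k \o cov_map h)) => t.
rewrite [LHS]cov_mapE [RHS](congr1 (cov_map k) (cov_mapE h t)) [RHS]cov_mapE.
by congr (gen _); apply: val_inj.
Qed.

(* The direct sum, over p and x in F p, of the functors Z[Hom(p, _)]. *)
Definition cover : functor := Functor cov_map_id cov_map_comp.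

Lemma cov_desc_natural (G : functor) (s : forall p, F p -> G p) p q
    (h : (p <= q)%O) x :
  let d r := free_lift (fun t : cov_gen r =>
    fmap G (valP t) (s (tag (val t)) (tagged (val t)))) in
  d q (fmap cover h x) = fmap G h (d p x).
Proof.
move=> d; apply: (@free_ext _ _ (d q \o cov_map h) (fmap G h \o d p)) => t.
rewrite [LHS](congr1 (d q) (cov_mapE h t)) [LHS]free_liftE.
rewrite [RHS](congr1 (fmap G h) (free_liftE _ t)); exact: fmap_comp.
Qed.

Definition cov_desc (G : functor) (s : forall p, F p -> G p) :
  nat_trans cover G := NatTrans (@cov_desc_natural G s).

Lemma cov_descE (G : functor) (s : forall p, F p -> G p) q (t : cov_gen q) :
  cov_desc s q (gen t) = fmap G (valP t) (s (tag (val t)) (tagged (val t))).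
Proof. exact: free_liftE. Qed.

Definition cov_unit p (x : F p) : cov_gen p := exist _ (mk_elt x) (lexx p).

Definition cov_aug : nat_trans cover F := cov_desc (fun p x => x).

Lemma cov_aug_epi : nt_epi cov_aug.
Proof.
by move=> p y; exists (gen (cov_unit y)); rewrite cov_descE fmap_id.
Qed.

Lemma cover_projective : projective cover.
Proof.
move=> A B e f epi_e.
have s_ex p (x : F p) : exists y, e p y = f p (gen (cov_unit x)) by apply: epi_e.
pose s p x := projT1 (cid (s_ex p x)).
have sE p x : e p (s p x) = f p (gen (cov_unit x)) 
  by exact: (projT2 (cid (s_ex p x))).
exists (cov_desc s) => p x.
apply: (@free_ext _ _ (e p \o cov_desc s p) (f p)) => t.
rewrite [LHS](congr1 (e p) (cov_descE s t)) nt_natural sE -nt_natural.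
congr (f p _); apply: etrans (cov_mapE _ _) _.
by congr (gen _); apply: val_inj => /=; case: (val t).
Qed.

End FreeCover.

Section KernelFunctor.

Variables (F G : functor) (a : nat_trans F G).

Definition kerf_obj p : zmodType := ker (a p).

Lemma kerf_map_subproof p q (h : (p <= q)%O) (x : kerf_obj p) :
  fmap F h (ker_val x) \in kerp (a q).
Proof. by rewrite unfold_in nt_natural kerP raddf0. Qed.

Definition kerf_fun p q (h : (p <= q)%O) (x : kerf_obj p) : kerf_obj q :=
  exist (fun y => y \in kerp (a q)) _ (kerf_map_subproof h x).

Lemma kerf_zmod_morphism p q (h : (p <= q)%O) : zmod_morphism (kerf_fun h).
Proof. by move=> x y; apply: val_inj; rewrite /= !raddfB. Qed.

Definition kerf_map p q (h : (p <= q)%O) : {additive kerf_obj p -> kerf_obj q} :=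
  mk_additive (kerf_zmod_morphism h).

Lemma kerf_map_id p (h : (p <= p)%O) x : kerf_map h x = x.
Proof. by apply: val_inj; rewrite /= fmap_id. Qed.

Lemma kerf_map_comp p q r (h : (p <= q)%O) (k : (q <= r)%O) (l : (p <= r)%O) x :
  kerf_map l x = kerf_map k (kerf_map h x).
Proof. by apply: val_inj; rewrite /= (fmap_comp h k). Qed.

Definition kerf : functor := Functor kerf_map_id kerf_map_comp.

Lemma kerf_val_natural p q (h : (p <= q)%O) (x : kerf p) :
  ker_val (fmap kerf h x) = fmap F h (ker_val x).
Proof. by []. Qed.

Definition kerf_val : nat_trans kerf F := NatTrans kerf_val_natural.

End KernelFunctor.

Section Existence.

Variable F : functor.

Fixpoint syzygy (n : nat) : functor :=
  if n is m.+1 then kerf (cov_aug (syzygy m)) else F.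

Definition syz_d n : nat_trans (cover (syzygy n.+1)) (cover (syzygy n)) :=
  nt_comp (kerf_val (cov_aug (syzygy n))) (cov_aug (syzygy n.+1)).

Lemma syz_im n p y :
  cov_aug (syzygy n) p y = 0 <-> exists x, syz_d n p x = y.
Proof.
split=> [y0|[x <-]]; last exact: kerP.
have yk : y \in kerp (cov_aug (syzygy n) p) by rewrite unfold_in y0.
have [x xE] := @cov_aug_epi (syzygy n.+1) p (exist _ y yk).
by exists x; apply: (congr1 ker_val xE).
Qed.

Lemma resolution_exists : inhabited (resolution F).
Proof.
exists; apply: (@Resolution F (fun n => cover (syzygy n)) syz_d (cov_aug F)).
- by move=> n; apply: cover_projective.
- exact: cov_aug_epi.
- exact: (@syz_im 0).
- move=> n p y; rewrite -syz_im; split=> [y0|y0]; 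
    last by rewrite [LHS](congr1 ker_val y0) raddf0.
  exact: val_inj.
Qed.

(* Resolutions are fixed by choice, so nothing but [resolution] is known of
   them. *)
Definition chosen_resolution : resolution F :=
  inhabited_witness resolution_exists.

End Existence.

(* Homology of the complex obtained from a projective resolution P of F by
   applying colim, the augmentation being dropped. *)
Definition colim_homology (F : functor) (P : resolution F) (j : nat) : zmodType :=
  if j is i.+1 then
    homology (colim_map (res_d P i.+1)) (colim_map (res_d P i))
  else
    homology (colim_map (res_d P 0%N)) (\0 : {additive colim (P 0%N) -> colim (P 0%N)}).

(* The j-th left derived functor of colim, on objects. *)
Definition colim_derived (j : nat) (F : functor) : zmodType :=
  colim_homology (chosen_resolution F) j.

End FunctorCategory.

Section GradedPoset.

Variables (disp : Order.disp_t) (C : porderType disp).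

Definition precedes (p q : C) : Prop :=
  (p < q)%O /\ forall r : C, (p <= r)%O -> (r <= q)%O -> r = p \/ r = q.

Definition grading (deg : C -> int) : Prop :=
  (forall p q : C, (p < q)%O -> deg p < deg q) /\
  (forall p q : C, precedes p q -> deg q = deg p + 1).

Definition bounded_below (deg : C -> int) : Prop :=
  exists m : int, forall p : C, m <= deg p.

End GradedPoset.

(* Main.v *)
(** Let [P] be a projective resolution of [H], and let [K_n] be the [n]-th
    syzygy of [H] in [P] (so that [K_0 = H]).  The tail of [P] from degree [n]
    on is a projective resolution of [K_n], whose first colimit homology is that
    of [P] in degree [n + 1].  Finally the first colimit homology of a functor
    does not depend on the resolution, by the comparison of projective
    resolutions carried out in degrees at most 2. *)
Require Import Defs.
From mathcomp Require Import all_boot all_order all_algebra.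

Set Implicit Arguments.
Unset Strict Implicit.
Unset Printing Implicit Defensive.

Import GRing.Theory.
Local Open Scope ring_scope.

(** * Maps induced on homology *)

Section HomologyProjection.

Variables (A B D : zmodType) (f : {additive A -> B}) (g : {additive B -> D}).

Definition homology_pi : {additive ker g -> homology f g} :=
  quo_pi (boundary0 f g) (@boundaryB _ _ _ f g).

Lemma homology_pi_surj y : exists x, homology_pi x = y.
Proof. exact: quo_pi_surj. Qed.

Lemma homology_pi_eq (x y : ker g) :
  (exists a, f a = ker_val x - ker_val y) -> homology_pi x = homology_pi y.
Proof.
move=> [a fa]; apply/eqP; rewrite -subr_eq0 -raddfB; apply/eqP/quo_pi_eq0.
by exists a; rewrite raddfB.
Qed.

End HomologyProjection.

Arguments homology_pi {A B D} f g.

Section HomologyMap.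

Variables (A B D A' B' D' : zmodType).
Variables (f : {additive A -> B}) (g : {additive B -> D}).
Variables (f' : {additive A' -> B'}) (g' : {additive B' -> D'}).
Variable b : {additive B -> B'}.
Hypothesis b_cycle : forall x, g x = 0 -> g' (b x) = 0.
Hypothesis b_boundary : forall a, exists a', f' a' = b (f a).

Lemma ker_map_subproof (x : ker g) : b (ker_val x) \in kerp g'.
Proof. by rewrite unfold_in b_cycle ?kerP. Qed.

Definition ker_map_fun (x : ker g) : ker g' :=
  exist (fun y => y \in kerp g') _ (ker_map_subproof x).

Lemma ker_map_zmod_morphism : zmod_morphism ker_map_fun.
Proof. by move=> x y; apply: val_inj; rewrite /= !raddfB. Qed.

Definition ker_map : {additive ker g -> ker g'} :=
  mk_additive ker_map_zmod_morphism.

Lemma homology_map_boundary (x : ker g) :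
  boundary f x -> (homology_pi f' g' \o ker_map) x = 0.
Proof.
move=> [a fa]; apply/quo_pi_eq0; have [a' fa'] := b_boundary a.
by exists a'; rewrite fa' fa.
Qed.

Definition homology_map : {additive homology f g -> homology f' g'} :=
  quo_lift (boundary0 f g) (@boundaryB _ _ _ f g) homology_map_boundary.

Lemma homology_mapE x :
  homology_map (homology_pi f g x) = homology_pi f' g' (ker_map x).
Proof. exact: quo_liftE. Qed.

End HomologyMap.

(** Only the middle maps [b] and [b'] are data: they induce maps on homology as soon as cycles go to
    cycles and boundaries to boundaries. These are mutually inverse because the composites differ
    from the identity by a boundary on every cycle. *)
Lemma homology_iso (A B D A' B' D' : zmodType)
    (f : {additive A -> B}) (g : {additive B -> D})
    (f' : {additive A' -> B'}) (g' : {additive B' -> D'})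
    (b : {additive B -> B'}) (b' : {additive B' -> B}) :
  (forall x, g x = 0 -> g' (b x) = 0) ->
  (forall a, exists a', f' a' = b (f a)) ->
  (forall x, g' x = 0 -> g (b' x) = 0) ->
  (forall a', exists a, f a = b' (f' a')) ->
  (forall x, g x = 0 -> exists a, f a = b' (b x) - x) ->
  (forall x, g' x = 0 -> exists a', f' a' = b (b' x) - x) ->
  homology f g ≅ homology f' g'.
Proof.
move=> bc bb bc' bb' bK bK'.
exists (homology_map bc bb); exists (homology_map bc' bb') => y.
  have [x <-] := homology_pi_surj y.
  by rewrite !homology_mapE; apply: homology_pi_eq; apply: bK; apply: kerP.
have [x <-] := homology_pi_surj y.
by rewrite !homology_mapE; apply: homology_pi_eq; apply: bK'; apply: kerP.
Qed.

(** * Functoriality of the colimit *)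

Section ColimitHomology.

Variables (disp : Order.disp_t) (C : porderType disp).
Implicit Types F G H P : functor C.

(** Both maps are the descent of one cocone, the legs of [g]. *)
Lemma colim_ext F (M : zmodType) (f g : {additive colim F -> M}) :
  (forall p x, f (colim_in F p x) = g (colim_in F p x)) -> f =1 g.
Proof.
move=> fg y.
have co p q (h : (p <= q)%O) x :
    (g \o colim_in F q) (fmap F h x) = (g \o colim_in F p) x.
  exact: (congr1 g (colim_in_map h x)).
have fE : forall p x, f (colim_in F p x) = (g \o colim_in F p) x by [].
have gE : forall p x, g (colim_in F p x) = (g \o colim_in F p) x by [].
by rewrite (colim_desc_unique co fE) (colim_desc_unique co gE).
Qed.

Lemma colim_map_in F G (a : nat_trans F G) p x :
  colim_map a (colim_in F p x) = colim_in G p (a p x).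
Proof. exact: colim_descE. Qed.

(** Serves as functoriality of [colim_map]: squares of a chain map stay commutative after taking
    colimits. *)
Lemma colim_map_square F G G' H (a : nat_trans F G) (b : nat_trans G H)
    (a' : nat_trans F G') (b' : nat_trans G' H) :
  (forall p x, b p (a p x) = b' p (a' p x)) ->
  forall y, colim_map b (colim_map a y) = colim_map b' (colim_map a' y).
Proof.
move=> ab.
apply: (@colim_ext _ _ (colim_map b \o colim_map a)
                       (colim_map b' \o colim_map a')) => p x.
rewrite -[LHS]/(colim_map _ (colim_map _ _)).
by rewrite -[RHS]/(colim_map _ (colim_map _ _)) !colim_map_in ab.
Qed.

(** * Differences and lifts of natural transformations *)

Section Sub.

Variables (F G : functor C) (a b : nat_trans F G).

Lemma nt_sub_natural p q (h : (p <= q)%O) x :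
  (a q \- b q) (fmap F h x) = fmap G h ((a p \- b p) x).
Proof. by rewrite /= !nt_natural raddfB. Qed.

Definition nt_sub : nat_trans F G := NatTrans nt_sub_natural.

End Sub.

Section Corestriction.

Variables (F G H : functor C) (a : nat_trans G H) (f : nat_trans F G).
Hypothesis af0 : forall p x, a p (f p x) = 0.

Lemma nt_corestr_subproof p (x : F p) : f p x \in kerp (a p).
Proof. by rewrite unfold_in af0. Qed.

Definition nt_corestr_fun p (x : F p) : kerf a p :=
  exist (fun y => y \in kerp (a p)) _ (nt_corestr_subproof x).

Lemma nt_corestr_zmod_morphism p : zmod_morphism (@nt_corestr_fun p).
Proof. by move=> x y; apply: val_inj; rewrite /= raddfB. Qed.

Definition nt_corestr_app p : {additive F p -> kerf a p} :=
  mk_additive (@nt_corestr_zmod_morphism p).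

Lemma nt_corestr_natural p q (h : (p <= q)%O) x :
  nt_corestr_app q (fmap F h x) = fmap (kerf a) h (nt_corestr_app p x).
Proof. by apply: val_inj; rewrite /= nt_natural. Qed.

Definition nt_corestr : nat_trans F (kerf a) := NatTrans nt_corestr_natural.

End Corestriction.

Lemma nt_corestr_epi F G H (b : nat_trans F G) (a : nat_trans G H)
    (ab0 : forall p x, a p (b p x) = 0) :
  exact_at b a -> nt_epi (nt_corestr ab0).
Proof.
move=> ex p y; have [x xE] := (ex p (ker_val y)).1 (kerP y).
by exists x; apply: val_inj.
Qed.

Lemma exact_at_comp0 F G H (b : nat_trans F G) (a : nat_trans G H) :
  exact_at b a -> forall p x, a p (b p x) = 0.
Proof. by move=> ex p x; apply/ex; exists x. Qed.

(** Projectivity lifts through epimorphisms only. By exactness [b] is epi onto the kernel of [a],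
    and [f] lands in that kernel. *)
Lemma projective_lift P F G H (b : nat_trans F G) (a : nat_trans G H)
    (f : nat_trans P G) :
  projective P -> exact_at b a -> (forall p x, a p (f p x) = 0) ->
  exists g : nat_trans P F, forall p x, b p (g p x) = f p x.
Proof.
move=> projP ex af0; have ab0 := exact_at_comp0 ex.
have [g gE] := projP _ _ _ (nt_corestr af0) (nt_corestr_epi ab0 ex).
by exists g => p x; apply: (congr1 ker_val (gE p x)).
Qed.

Arguments res_aug_epi {disp C F} r p y.
Arguments res_exact0 {disp C F} r p y.
Arguments res_exactS {disp C F} r n p y.
Arguments res_projective {disp C F} r n [A B e] f _.

(** * Truncated resolutions and syzygies *)

Section Truncation.

Variables (F : functor C) (P : resolution F).

Definition trunc_aug : nat_trans (P 1%N) (kerf (res_aug P)) :=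
  nt_corestr (exact_at_comp0 (res_exact0 P)).

(** The inclusion of the kernel is injective, so [trunc_aug] and [res_d P 0] vanish on the same
    elements. *)
Lemma trunc_exact0 : exact_at (res_d P 1) trunc_aug.
Proof.
move=> p y; rewrite -(res_exactS P 0 p y); split=> [y0|y0].
  exact: (congr1 ker_val y0).
exact: val_inj.
Qed.

Definition truncation : resolution (kerf (res_aug P)) :=
  @Resolution _ _ _ (fun n => P n.+1) (fun n => res_d P n.+1) trunc_aug
    (fun n => res_projective P n.+1) (nt_corestr_epi _ (res_exact0 P))
    trunc_exact0 (fun n => res_exactS P n.+1).

End Truncation.

(** The recursion changes the functor and its resolution together, so that each step starts from a
    resolution of the current syzygy. *)
Fixpoint res_syzygy (n : nat) (F : functor C) (P : resolution F) : functor C :=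
  if n is m.+1 then res_syzygy m (truncation P) else F.

Lemma res_syzygy_resolution n F (P : resolution F) :
  exists Q : resolution (res_syzygy n P),
    colim_homology Q 1 = colim_homology P n.+1.
Proof.
elim: n F P => [|n IHn] F P; first by exists P.
(* Truncating lowers the degree by one definitionally, hence an equality of groups and not merely an
   isomorphism. *)
by have [Q QE] := IHn _ (truncation P); exists Q; rewrite QE.
Qed.

(** * Comparison of resolutions in low degrees *)

Record chain_map2 F (P Q : resolution F) := ChainMap2 {
  cm0 : nat_trans (P 0%N) (Q 0%N);
  cm1 : nat_trans (P 1%N) (Q 1%N);
  cm2 : nat_trans (P 2%N) (Q 2%N);
  cm_aug : forall p x, res_aug Q p (cm0 p x) = res_aug P p x;
  cm_d0 : forall p x, res_d Q 0 p (cm1 p x) = cm0 p (res_d P 0 p x);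
  cm_d1 : forall p x, res_d Q 1 p (cm2 p x) = cm1 p (res_d P 1 p x)
}.

(** Each component is lifted from the previous one composed with the differential of [P]. For
    homology in degree 1, [cm0] controls cycles and [cm2] boundaries, so degree 2 is the last one
    needed. *)
Lemma chain_map2_exists F (P Q : resolution F) : inhabited (chain_map2 P Q).
Proof.
have [f0 f0E] :=
  res_projective P 0 (res_aug P) (res_aug_epi Q).
have [|f1 f1E] := projective_lift (f := nt_comp f0 (res_d P 0))
    (res_projective P 1) (res_exact0 Q).
  by move=> p x; rewrite /= f0E (exact_at_comp0 (res_exact0 P)).
have [|f2 f2E] := projective_lift (f := nt_comp f1 (res_d P 1))
    (res_projective P 2) (res_exactS Q 0).
  by move=> p x; rewrite /= f1E /= (exact_at_comp0 (res_exactS P 0)) raddf0.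
by exists; exists f0 f1 f2.
Qed.

Lemma chain_map2_homotopy F (P Q : resolution F)
    (f : chain_map2 P Q) (g : chain_map2 Q P) :
  exists (s0 : nat_trans (P 0%N) (P 1%N)) (s1 : nat_trans (P 1%N) (P 2%N)),
  forall p x, res_d P 1 p (s1 p x) =
    cm1 g p (cm1 f p x) - x - s0 p (res_d P 0 p x).
Proof.
have idN n : forall p q (h : (p <= q)%O) x,
    (idfun : {additive P n q -> P n q}) (fmap (P n) h x) =
    fmap (P n) h ((idfun : {additive P n p -> P n p}) x) by [].
pose id n : nat_trans (P n) (P n) := NatTrans (idN n).
(* In degree 0, [g f - 1] is killed by the augmentation, hence lifts to [s0]. *)
have [|s0 s0E] := projective_lift (f := nt_sub (nt_comp (cm0 g) (cm0 f)) (id 0))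
    (res_projective P 0) (res_exact0 P).
  by move=> p x; rewrite /= raddfB !cm_aug subrr.
(* In degree 1, [g f - 1 - s0 d] is killed by [d], since [d s0 = g f - 1] in degree 0. *)
have [|s1 s1E] := projective_lift
    (f := nt_sub (nt_sub (nt_comp (cm1 g) (cm1 f)) (id 1))
      (nt_comp s0 (res_d P 0)))
    (res_projective P 1) (res_exactS P 0).
  by move=> p x; rewrite /= !raddfB s0E /= !cm_d0 subrr.
by exists s0, s1.
Qed.

Lemma colim_chain_map2_homotopy F (P Q : resolution F)
    (f : chain_map2 P Q) (g : chain_map2 Q P) x :
  colim_map (res_d P 0) x = 0 ->
  exists a,
    colim_map (res_d P 1) a = colim_map (cm1 g) (colim_map (cm1 f) x) - x.
Proof.
move=> x0; have [s0 [s1 sE]] := chain_map2_homotopy f g.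
(* The homotopy identity passes to the colimit by checking it on the images of the [colim_in]; the
   [s0] term then vanishes on cycles. *)
have homot y : colim_map (res_d P 1) (colim_map s1 y) =
    colim_map (cm1 g) (colim_map (cm1 f) y) - y
    - colim_map s0 (colim_map (res_d P 0) y).
  apply: (@colim_ext _ _ (colim_map (res_d P 1) \o colim_map s1)
    (((colim_map (cm1 g) \o colim_map (cm1 f)) \- idfun)
       \- (colim_map s0 \o colim_map (res_d P 0)))) => p z.
  rewrite -[LHS]/(colim_map _ (colim_map _ _)).
  rewrite -[RHS]/(colim_map _ (colim_map _ _) - _
    - colim_map _ (colim_map _ _)).
  by rewrite !colim_map_in sE !raddfB.
by exists (colim_map s1 x); rewrite homot x0 raddf0 subr0.
Qed.

Lemma colim_homology1_indep F (P Q : resolution F) :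
  colim_homology P 1 ≅ colim_homology Q 1.
Proof.
have [f] := chain_map2_exists P Q; have [g] := chain_map2_exists Q P.
have cycle (P' Q' : resolution F) (h : chain_map2 P' Q') x :
    colim_map (res_d P' 0) x = 0 ->
    colim_map (res_d Q' 0) (colim_map (cm1 h) x) = 0.
  by move=> x0; rewrite (colim_map_square (cm_d0 h)) x0 raddf0.
have bnd (P' Q' : resolution F) (h : chain_map2 P' Q') a :
    exists a', colim_map (res_d Q' 1) a' =
      colim_map (cm1 h) (colim_map (res_d P' 1) a).
  by exists (colim_map (cm2 h) a); rewrite (colim_map_square (cm_d1 h)).
apply: (homology_iso (b := colim_map (cm1 f)) (b' := colim_map (cm1 g))).
- exact: cycle.
- exact: bnd.
- exact: cycle.
- exact: bnd.
- exact: colim_chain_map2_homotopy.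
- exact: colim_chain_map2_homotopy.
Qed.

End ColimitHomology.

Theorem lemma9 (disp : Order.disp_t) (C : porderType disp) (deg : C -> int)
    (deg_grading : grading deg) (deg_bounded : bounded_below deg)
    (H : functor C) :
  exists K : nat -> functor C,
    K 0%N = H /\
    forall j : nat, (1 <= j)%N ->
      colim_derived j H ≅ colim_derived 1 (K (j - 1)%N).
Proof.
(* With [j = n.+1], the index [j - 1] is [n]. *)
exists (fun n => res_syzygy n (chosen_resolution H)); split=> // -[//|n] _.
rewrite subn1.
have [Q QE] := res_syzygy_resolution n (chosen_resolution H).
(* The tail [Q] and the chosen resolution of the syzygy may differ, which is where independence
   enters. *)
by rewrite /colim_derived -QE; apply: colim_homology1_indep.
Qed.
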